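(* Let $(r_h^n,s_h^n)$, together with $p_h^{n+\frac12},q_h^{n+\frac12}$, be a solution in $V_h^k$, under periodic boundary conditions on $[L_f,L_r]$, of the symplectic local discontinuous Galerkin method defined in the context for the one-dimensional stochastic linear Schr\''odinger equation $i\,du-(u_{xx}+Q(x)u)\,dt=u\circ dW$, $u(x,0)=u_0(x)$, with numerical fluxes $\hat p=p_h^+$, $\hat r=r_h^-$, $\hat q=q_h^+$, $\hat s=s_h^-$, and put $u_h^n=r_h^n+is_h^n$. Then the discrete charge conservation law holds: $$\int_{L_f}^{L_r}|u_h^{n+1}|^2\,dx=\int_{L_f}^{L_r}|u_h^{n}|^2\,dx,\qquad n=0,1,2,\dots,N.$$
   Context: Setting: $\mathcal O=[L_f,L_r]$ with periodic boundary conditions; $Q\in\mathbb H^3(\mathcal O)$ real-valued; $W(t,x)=\sum_k\beta_k(t)\,\phi e_k(x)$ is a real-valued Wiener process, with $(e_k)$ an orthonormal basis of $\mathbb L^2(\mathcal O)$, $(\beta_k)$ independent real Brownian motions and $\phi$ Hilbert--Schmidt from $\mathbb L^2$ to $\mathbb H^\gamma$ (the $L^2$-based Sobolev space of order $\gamma$); $\circ$ is the Stratonovich product. $\Delta t=T/N$, $t_n=n\Delta t$. Truncated increments: $\Delta\tilde W_n=\sum_k\sqrt{\Delta t}\,\zeta^\kappa_{k,n}\phi e_k(x)$, where $\xi_{k,n}=(\beta_k(t_{n+1})-\beta_k(t_n))/\sqrt{\Delta t}$, $\kappa=\sqrt{4|\ln(\Delta t)|}$, and $\zeta^\kappa_{k,n}$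 equals $\kappa$ if $\xi_{k,n}>\kappa$, $\xi_{k,n}$ if $|\xi_{k,n}|\le\kappa$, $-\kappa$ if $\xi_{k,n}<-\kappa$. Mesh: $L_f=x_{\frac12}<x_{\frac32}<\dots<x_{J+\frac12}=L_r$, $I_j=[x_{j-\frac12},x_{j+\frac12}]$, $\Delta x_j=x_{j+\frac12}-x_{j-\frac12}$, $h=\max_j\Delta x_j$, and $\Delta x_j\ge ch$ for all $j$ with $c>0$ independent of $h$. $V_h^k$ is the space of real functions whose restriction to each $I_j$ is a polynomial of degree at most $k$. For a piecewise function $v$, $v^{+}_{j+\frac12}$ and $v^-_{j+\frac12}$ are the values at $x_{j+\frac12}$ from the right cell $I_{j+1}$ and the left cell $I_j$; by periodicity the points $x_{\frac12}$ and $x_{J+\frac12}$ are identified. Method: write $v^{n+\frac12}=\frac12(v^{n+1}+v^n)$ and $Q_h=Q$ for the potential in the discrete scheme. Find $r_h,p_h,s_h,q_h\in V_h^k$ such that for all $\nu_h,\omega_h,\alpha_h,\beta_h\in V_h^k$, all $1\le j\le J$ and all $n=0,1,\dots,N$: $$\int_{I_j}r_h^{n+1}\nu_h\,dx-\int_{I_j}r_h^n\nu_h\,dx-\Delta t\big[(\hat p^{n+\frac12}\nu_h^-)_{j+\frac12}-(\hat p^{n+\frac12}\nu_h^+)_{j-\frac12}\big]+\Delta t\int_{I_j}\big(p_h^{n+\frac12}(\nu_h)_x-s_h^{n+\frac12}Q_h\nu_h\big)dx-\int_{I_j}s_h^{n+\frac12}\nu_h\,\Delta\tilde W_n\,dx=0,$$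 $$\int_{I_j}p_h^{n+\frac12}\omega_h\,dx+\int_{I_j}s_h^{n+\frac12}(\omega_h)_x\,dx-\big[(\hat s^{n+\frac12}\omega_h^-)_{j+\frac12}-(\hat s^{n+\frac12}\omega_h^+)_{j-\frac12}\big]=0,$$ $$\int_{I_j}s_h^{n+1}\alpha_h\,dx-\int_{I_j}s_h^n\alpha_h\,dx+\Delta t\big[(\hat q^{n+\frac12}\alpha_h^-)_{j+\frac12}-(\hat q^{n+\frac12}\alpha_h^+)_{j-\frac12}\big]-\Delta t\int_{I_j}\big(q_h^{n+\frac12}(\alpha_h)_x-r_h^{n+\frac12}Q_h\alpha_h\big)dx+\int_{I_j}r_h^{n+\frac12}\alpha_h\,\Delta\tilde W_n\,dx=0,$$ $$\int_{I_j}q_h^{n+\frac12}\beta_h\,dx+\int_{I_j}r_h^{n+\frac12}(\beta_h)_x\,dx-\big[(\hat r^{n+\frac12}\beta_h^-)_{j+\frac12}-(\hat r^{n+\frac12}\beta_h^+)_{j-\frac12}\big]=0.$$ The identity in the claim is understood almost surely. *)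

(* Defs.v *)
From HB Require Import structures.
From mathcomp Require Import all_boot all_order all_algebra.
From mathcomp Require Import all_classical all_reals all_analysis.
From mathcomp Require Import complex.

Set Implicit Arguments.
Unset Strict Implicit.
Unset Printing Implicit Defensive.

Import Order.TTheory GRing.Theory Num.Theory.
Import numFieldNormedType.Exports.

Local Open Scope classical_set_scope.
Local Open Scope ring_scope.

(** Elements of L^2(a, b) are represented by functions [f : R -> R], of which only
the restriction to [a, b] matters ([f \_ A] is [f] on [A] and 0 elsewhere);
equality in L^2 is equality almost everywhere on [a, b]. *)
Section Sobolev.
Context {R : realType} (a b : R).

Local Notation mu := (@lebesgue_measure R).
Local Notation O := (`[a, b]%classic : set R).

Definition L2 (f : R -> R) : Prop := f \_ O \in Lfun mu 2%:E.

Definition L2norm (f : R -> R) : \bar R := 'N[mu]_2%:E [EFin \o (f \_ O)].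

Definition L2inner (f g : R -> R) : R := \int[mu]_(x in O) (f x * g x).

Definition orthonormal_basis (e : nat -> R -> R) : Prop :=
  [/\ forall i, L2 (e i),
      forall i j, L2inner (e i) (e j) = (i == j)%:R
    & forall f, L2 f ->
        (fun K => L2norm (fun x => f x - \sum_(i < K) L2inner f (e i) * e i x))
          @ \oo --> 0%E].

Definition test_function (psi : R -> R) : Prop :=
  (forall n x, derivable (derive1n n psi) x 1) /\
  (exists a' b', [/\ a < a', b' < b & forall x, x \notin `[a', b'] -> psi x = 0]).

Definition weak_derivative (i : nat) (f g : R -> R) : Prop :=
  [/\ L2 f, L2 g
    & forall psi, test_function psi ->
        \int[mu]_(x in O) (f x * derive1n i psi x) =
        (-1) ^+ i * \int[mu]_(x in O) (g x * psi x)].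

Definition slobodeckij (theta : R) (g : R -> R) : \bar R :=
  if theta == 0 then 0%E else
  (\int[mu]_(x in O) \int[mu]_(y in O)
     (`|g x - g y| ^+ 2 / `|x - y| `^ (1 + 2 * theta))%:E)%E.

(** Squared norm of H^gamma(a, b) for a real order [gamma >= 0]: weak
derivatives up to the integer part of [gamma], and the Slobodeckij seminorm for
the fractional part.  The infimum ranges over representatives of the weak
derivatives, which all give the same value; it is +oo if they do not exist. *)
Definition sobolev_sqnorm (gamma : R) (f : R -> R) : \bar R :=
  let m := Num.truncn gamma in
  ereal_inf [set (\sum_(i < m.+1) (L2norm (D i) ^+ 2)
                  + slobodeckij (gamma - m%:R) (D m))%E
            | D in [set D : nat -> R -> R |
                    forall i, (i <= m)%N -> weak_derivative i f (D i)]].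

Definition sobolev (gamma : R) (f : R -> R) : Prop :=
  L2 f /\ (sobolev_sqnorm gamma f < +oo)%E.

(** Linearity is up to equality almost everywhere; together with boundedness it
makes [phi] compatible with equality in L^2. *)
Definition hilbert_schmidt (gamma : R) (phi : (R -> R) -> (R -> R)) : Prop :=
  [/\ forall f, L2 f -> sobolev gamma (phi f),
      forall (c : R) f g, L2 f -> L2 g ->
        {ae mu, forall x, O x ->
          phi (fun y => c * f y + g y) x = c * phi f x + phi g x},
      exists C : R, forall f, L2 f ->
        (sobolev_sqnorm gamma (phi f) <= C%:E * L2norm f ^+ 2)%E
    & exists e, orthonormal_basis e /\
        (\sum_(0 <= i <oo) sobolev_sqnorm gamma (phi (e i)) < +oo)%E].

End Sobolev.

Section Noise.
Context {d : measure_display} {Omega : measurableType d} {R : realType}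
        (P : probability Omega R).

Definition sigma_of (I : Type) (D : set I) (X : I -> Omega -> R) :
    set (set Omega) :=
  <<s [set X t @^-1` B | t in D & B in (@measurable _ R)] >>.

Definition independent (F G : set (set Omega)) : Prop :=
  forall A B, F A -> G B -> P (A `&` B) = (P A * P B)%E.

Definition mutually_independent (F : nat -> set (set Omega)) : Prop :=
  forall (l : seq nat) (A : nat -> set Omega), uniq l ->
    (forall k, k \in l -> F k (A k)) ->
    P (\bigcap_(k in [set` l]) A k) = (\prod_(k <- l) P (A k))%E.

Definition brownian_motion (B : R -> {RV P >-> R}) : Prop :=
  [/\ {ae P, forall w, B 0 w = 0},
      forall s t, 0 <= s -> s <= t ->
        independent (sigma_of `[0, s] (fun u => B u : Omega -> R))
                    (sigma_of [set: unit] (fun=> B t \- B s)),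
      forall s t, 0 <= s -> s < t -> forall A, measurable A ->
        P ((B t \- B s) @^-1` A) = normal_prob 0 (Num.sqrt (t - s)) A
    & {ae P, forall w, {within `[0, +oo[, continuous (fun t => B t w)}}].

Definition independent_brownian_motions (B : nat -> R -> {RV P >-> R}) : Prop :=
  (forall k, brownian_motion (B k)) /\
  mutually_independent
    (fun k => sigma_of `[0, +oo[ (fun t => B k t : Omega -> R)).

Definition truncation (kappa xi : R) : R :=
  if kappa < xi then kappa else if xi < - kappa then - kappa else xi.

(** The truncation threshold kappa. *)
Definition trunc_level (dt : R) : R := Num.sqrt (4 * `|ln dt|).

(** zeta_(k, n)^kappa, with t_n = n * dt *)
Definition trunc_normal (B : nat -> R -> {RV P >-> R}) (dt : R) (k n : nat)
    (w : Omega) : R :=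
  truncation (trunc_level dt)
    ((B k (n.+1%:R * dt) w - B k (n%:R * dt) w) / Num.sqrt dt).

(** [dW] is the n-th truncated increment
[\sum_k sqrt dt * zeta_(k, n) * phi e_k], the series being summed in
L^2(Omega; L^2(a, b)). *)
Definition truncated_increment (a b : R) (B : nat -> R -> {RV P >-> R})
    (phi : (R -> R) -> (R -> R)) (e : nat -> R -> R) (dt : R) (n : nat)
    (dW : Omega -> R -> R) : Prop :=
  measurable_fun ([set: Omega] `*` `[a, b]) (fun z : Omega * R => dW z.1 z.2) /\
  (fun K => \int[P]_w
     (L2norm a b (fun x => (dW w x -
        \sum_(k < K) Num.sqrt dt * trunc_normal B dt k n w * phi (e k) x)%R)
      ^+ 2))%E @ \oo --> 0%E.

End Noise.

(** Nodes are numbered from 0: the cell [cell M j], [j < ncell M], is I_(j+1), and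
[node M j] is x_(j+1/2). *)
Record mesh (R : realType) (a b : R) := Mesh {
  ncell : nat;
  node : nat -> R;
  node_first : node 0 = a;
  node_last : node ncell = b;
  node_lt : forall j, (j < ncell)%N -> node j < node j.+1
}.

Section LDG.
Context {R : realType} {a b : R} (M : mesh a b).

Local Notation mu := (@lebesgue_measure R).

Definition cell (j : nat) : set R := `[node M j, node M j.+1].

Definition cell_size (j : nat) : R := node M j.+1 - node M j.

Definition mesh_size : R := \big[Num.max/0]_(j < ncell M) cell_size j.

(** The elements of V_h^k are double-valued at the nodes, so their values there
are left free; only the one-sided traces below are used. *)
Definition dg_space (k : nat) (v : R -> R) : Prop :=
  forall j, (j < ncell M)%N ->
    exists2 p : {poly R}, (size p <= k.+1)%N
      & forall x, x \in `]node M j, node M j.+1[ -> v x = p.[x].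

(** Traces v^- and v^+ at [node M i]; by periodicity the first and the last
nodes are identified. *)
Definition trace_minus (v : R -> R) (i : nat) : R :=
  lim (v x @[x --> (node M (if i == 0%N then ncell M else i))^'-]).

Definition trace_plus (v : R -> R) (i : nat) : R :=
  lim (v x @[x --> (node M (if i == ncell M then 0%N else i))^'+]).

Definition midpoint (v : nat -> R -> R) (n : nat) : R -> R :=
  fun x => (v n.+1 x + v n x) / 2.

(** [(fhat nu^-)_(j+1/2) - (fhat nu^+)_(j-1/2)] on [cell M j] *)
Definition flux_jump (fhat : nat -> R) (nu : R -> R) (j : nat) : R :=
  fhat j.+1 * trace_minus nu j.+1 - fhat j * trace_plus nu j.

(** [phat], [rhat], [qhat], [shat] compute numerical fluxes at the nodes. *)
Definition sldg_step (k : nat) (Q : R -> R) (dt : R)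
    (phat rhat qhat shat : (R -> R) -> nat -> R)
    (dW : R -> R) (r p s q : nat -> R -> R) (n : nat) : Prop :=
  let rm := midpoint r n in let pm := midpoint p n in
  let sm := midpoint s n in let qm := midpoint q n in
  forall nu omega alpha beta : R -> R,
    dg_space k nu -> dg_space k omega -> dg_space k alpha -> dg_space k beta ->
  forall j, (j < ncell M)%N ->
  [/\ \int[mu]_(x in cell j) (r n.+1 x * nu x)
      - \int[mu]_(x in cell j) (r n x * nu x)
      - dt * flux_jump (phat pm) nu j
      + dt * \int[mu]_(x in cell j) (pm x * derive1 nu x - sm x * Q x * nu x)
      - \int[mu]_(x in cell j) (sm x * nu x * dW x) = 0,
      \int[mu]_(x in cell j) (pm x * omega x)
      + \int[mu]_(x in cell j) (sm x * derive1 omega x)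
      - flux_jump (shat sm) omega j = 0,
      \int[mu]_(x in cell j) (s n.+1 x * alpha x)
      - \int[mu]_(x in cell j) (s n x * alpha x)
      + dt * flux_jump (qhat qm) alpha j
      - dt * \int[mu]_(x in cell j) (qm x * derive1 alpha x - rm x * Q x * alpha x)
      + \int[mu]_(x in cell j) (rm x * alpha x * dW x) = 0
    & \int[mu]_(x in cell j) (qm x * beta x)
      + \int[mu]_(x in cell j) (rm x * derive1 beta x)
      - flux_jump (rhat rm) beta j = 0].

(** One path of a solution on the time levels 0, ..., N + 1. *)
Definition sldg_solution (k N : nat) (Q : R -> R) (dt : R)
    (phat rhat qhat shat : (R -> R) -> nat -> R)
    (dW : nat -> R -> R) (r p s q : nat -> R -> R) : Prop :=
  (forall n, (n <= N.+1)%N ->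
     [/\ dg_space k (r n), dg_space k (p n), dg_space k (s n)
       & dg_space k (q n)]) /\
  (forall n, (n <= N)%N ->
     sldg_step k Q dt phat rhat qhat shat (dW n) r p s q n).

End LDG.

Definition discrete_charge {R : realType} (a b : R) (u : R -> R[i]) : R :=
  \int[@lebesgue_measure R]_(x in `[a, b]) (ComplexField.Normc.normc (u x) ^+ 2).

(* Main.v *)
Require Import Defs.
From HB Require Import structures.
From mathcomp Require Import all_boot all_order all_algebra.
From mathcomp Require Import all_classical all_reals all_analysis.
From mathcomp Require Import measurable_realfun.
From mathcomp Require Import complex.
From mathcomp Require Import ring lra.

Set Implicit Arguments.
Unset Strict Implicit.
Unset Printing Implicit Defensive.

Import Order.TTheory GRing.Theory Num.Theory.
Import numFieldNormedType.Exports.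

Local Open Scope classical_set_scope.
Local Open Scope ring_scope.

(** Write v0 and v1 for the values at two successive time levels and vm for the
midpoint.  On each cell, use the test functions nu = rm, alpha = sm, omega = qm
and beta = pm.  Since (v1 - v0) vm = (v1^2 - v0^2) / 2, adding the equations for
r and s makes half of the change of the charge of the cell appear.  The noise
contributes sm rm dW once with each sign, and so does the potential with
sm Q rm: this is the discrete form of the fact that these terms act on u by
multiplication by an imaginary number, which does not change its modulus.

It remains to treat the dispersive part.  The fluxes are alternating (p^+ with
r^-, and q^+ with s^-), so that the discrete derivative with fluxes v^- and the
one with fluxes w^+ are adjoint up to sign: when the derivative of v w is
integrated over a cell, everything cancels except the difference of w^+ v^-
between the two ends of the cell ([flux_jump_adjoint]).  Through the equations
for q and p, the integrals left over are that of qm pm and that of pm qm, with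
opposite signs.  Hence the change of the charge of a cell is a difference of
numerical fluxes between its ends ([sldg_cell_balance]), and these differences
telescope to zero over a periodic mesh ([sum_periodic_flux]).

The argument is pathwise.  The two noise integrals have the same integrand up
to commutativity and cancel as they stand, whereas the potential shares an
integral with pm rm', or qm sm', which has to be split; this is where the square
integrability of Q enters ([L2_dg_integrable]). *)

(** * Functions prescribed on an open interval *)

Section OpenInterval.
Context {R : realType}.
Local Notation mu := (@lebesgue_measure R).
Implicit Types (f g : R -> R) (x y : R).

(** Piecewise polynomials, and even more so their derivatives, are arbitrary at
the nodes, whereas cells are closed; the endpoints are negligible and affect
neither integrability nor the value of the integral. *)
Lemma integrable_itv_oo_cc f x y :
  mu.-integrable `]x, y[ (EFin \o f) -> mu.-integrable `[x, y] (EFin \o f).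
Proof.
move=> /integrableP[/measurable_EFinP mf foo].
have mfcc : measurable_fun `[x, y] f.
  exact/measurable_fun_itv_obnd_cbndP/measurable_fun_itv_bndo_bndcP.
apply/integrableP; split; first exact/measurable_EFinP.
rewrite integral_itv_bndoo//.
by apply/measurable_EFinP; exact: measurableT_comp.
Qed.

Lemma integrable_eq_itv_oo f g x y : {in `]x, y[, f =1 g} ->
  mu.-integrable `[x, y] (EFin \o g) -> mu.-integrable `[x, y] (EFin \o f).
Proof.
move=> fg ig; apply: integrable_itv_oo_cc.
have ig' : mu.-integrable `]x, y[ (EFin \o g).
  by apply: integrableS ig => //; exact: subset_itv_oo_cc.
apply: eq_integrable ig' => // z; rewrite inE => zxy /=.
by rewrite fg.
Qed.

Lemma Rintegral_eq_itv_oo f g x y : {in `]x, y[, f =1 g} ->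
  mu.-integrable `[x, y] (EFin \o g) ->
  \int[mu]_(z in `[x, y]) f z = \int[mu]_(z in `[x, y]) g z.
Proof.
move=> fg ig.
have if_ := integrable_eq_itv_oo fg ig.
rewrite /Rintegral; congr fine.
have moo h : mu.-integrable `[x, y] (EFin \o h) ->
    measurable_fun `]x, y[ (EFin \o h).
  move=> /measurable_int; apply: measurable_funS => //.
  exact: subset_itv_oo_cc.
rewrite [LHS]integral_itv_bndoo; last exact: moo.
rewrite [RHS]integral_itv_bndoo; last exact: moo.
by apply: eq_integral => z; rewrite inE /= => zxy; rewrite fg.
Qed.

End OpenInterval.

(** * Polynomials on an interval *)

Section Polynomial.
Context {R : realType}.
Local Notation mu := (@lebesgue_measure R).
Implicit Types (v : R -> R) (p q : {poly R}) (x y : R).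

Lemma within_continuous_horner p x y : {within `[x, y], continuous (horner p)}.
Proof. by apply: continuous_subspaceT; exact: continuous_horner. Qed.

Lemma integrable_horner p x y : mu.-integrable `[x, y] (EFin \o horner p).
Proof.
apply: continuous_compact_integrable; first exact: segment_compact.
exact: within_continuous_horner.
Qed.

Lemma derivable_oo_LRcontinuous_horner p x y :
  derivable_oo_LRcontinuous (horner p) x y.
Proof.
split; first by move=> z _; exact: derivable_horner.
- by apply: cvg_at_right_filter; exact: continuous_horner.
- by apply: cvg_at_left_filter; exact: continuous_horner.
Qed.

Lemma Rintegration_by_parts_horner p q x y : x < y ->
  \int[mu]_(z in `[x, y]) (p.[z] * q^`().[z])
  + \int[mu]_(z in `[x, y]) (q.[z] * p^`().[z]) =
  p.[y] * q.[y] - p.[x] * q.[x].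
Proof.
move=> xy.
rewrite (@Rintegration_by_parts _ (horner p) (horner q) (horner p^`())
  (horner q^`()))//; first last.
- by move=> z _; rewrite derivE.
- exact: derivable_oo_LRcontinuous_horner.
- exact: within_continuous_horner.
- by move=> z _; rewrite derivE.
- exact: derivable_oo_LRcontinuous_horner.
- exact: within_continuous_horner.
under [X in _ - X + _]eq_Rintegral do rewrite mulrC.
by rewrite subrK.
Qed.

Lemma lim_at_left_horner v p x y : x < y -> {in `]x, y[, v =1 horner p} ->
  lim (v z @[z --> y^'-]) = p.[y].
Proof.
move=> xy vp; apply: cvg_lim => //.
have : p.[z] @[z --> y^'-] --> p.[y].
  by apply: cvg_at_left_filter; exact: continuous_horner.
apply: cvg_trans; apply: near_eq_cvg; near=> z.
by rewrite vp// in_itv/=; apply/andP; split.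
Unshelve. all: by end_near. Qed.

Lemma lim_at_right_horner v p x y : x < y -> {in `]x, y[, v =1 horner p} ->
  lim (v z @[z --> x^'+]) = p.[x].
Proof.
move=> xy vp; apply: cvg_lim => //.
have : p.[z] @[z --> x^'+] --> p.[x].
  by apply: cvg_at_right_filter; exact: continuous_horner.
apply: cvg_trans; apply: near_eq_cvg; near=> z.
by rewrite vp// in_itv/=; apply/andP; split.
Unshelve. all: by end_near. Qed.

Lemma derive1_eq_horner v p x y : {in `]x, y[, v =1 horner p} ->
  {in `]x, y[, derive1 v =1 horner p^`()}.
Proof.
move=> vp z zxy; rewrite derivE !derive1E; apply: near_eq_derive.
by near=> t; apply: vp; near: t; exact: near_in_itvoo.
Unshelve. all: by end_near. Qed.

End Polynomial.

(** * Cells of a periodic mesh *)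

Section Mesh.
Context {R : realType} {a b : R} (M : mesh a b).
Local Notation mu := (@lebesgue_measure R).

Lemma node_le i j : (i <= j)%N -> (j <= ncell M)%N -> node M i <= node M j.
Proof.
elim: j => [|j IHj]; first by rewrite leqn0 => /eqP->.
rewrite leq_eqVlt => /predU1P[->//|]; rewrite ltnS => ij jM.
by rewrite (le_trans (IHj ij (ltnW jM)))// ltW// node_lt.
Qed.

Lemma measurable_cell j : measurable (cell M j).
Proof. exact: measurable_itv. Qed.

Lemma cell_sub j : (j < ncell M)%N -> cell M j `<=` `[a, b].
Proof.
move=> jM; apply: subset_itvScc; rewrite bnd_simp.
- by have := node_le (leq0n j) (ltnW jM); rewrite node_first.
- by have := node_le jM (leqnn _); rewrite node_last.
Qed.

Lemma Rintegral_mesh (f : R -> R) :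
  (forall j, (j < ncell M)%N -> mu.-integrable (cell M j) (EFin \o f)) ->
  \int[mu]_(x in `[a, b]) f x =
  \sum_(0 <= j < ncell M) \int[mu]_(x in cell M j) f x.
Proof.
move=> intf.
suff H m : (m <= ncell M)%N ->
    mu.-integrable `[node M 0, node M m] (EFin \o f) /\
    \int[mu]_(x in `[node M 0, node M m]) f x =
    \sum_(0 <= j < m) \int[mu]_(x in cell M j) f x.
  by have [] := H _ (leqnn _); rewrite node_last node_first.
elim: m => [_|m IHm mM].
  rewrite set_itv1 big_geq// Rintegral_set1; split=> //.
  apply/integrableP; split; first exact: measurable_fun_set1.
  by rewrite integral_set1.
have [im eqm] := IHm (ltnW mM).
have im1 : mu.-integrable `]node M m, node M m.+1] (EFin \o f).
  apply: integrableS (intf _ mM) => //; first exact: measurable_cell.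
  exact: subset_itv_oc_cc.
have E : `[node M 0, node M m.+1]%classic =
    `[node M 0, node M m] `|` `]node M m, node M m.+1].
  rewrite -itv_bndbnd_setU// bnd_simp; first exact/node_le/ltnW.
  exact/ltW/node_lt.
have iU : mu.-integrable `[node M 0, node M m.+1] (EFin \o f).
  move: im im1 => /integrableP[m1 h1] /integrableP[m2 h2].
  have mU : measurable_fun `[node M 0, node M m.+1] (EFin \o f).
    by rewrite E; apply/measurable_funU.
  apply/integrableP; split=> //; rewrite E.
  rewrite E in mU.
  rewrite ge0_integral_setU//; first exact: lte_add_pinfty.
    exact: measurableT_comp.
  apply/disj_setPS => x [] /=; rewrite !in_itv/= => /andP[_ xm] /andP[mx _].
  by rewrite ltNge xm in mx.
split=> //.
rewrite big_nat_recr//= -eqm.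
have := @Rintegral_itvB _ f (BLeft (node M 0)) (BRight (node M m.+1))
  (node M m) iU.
rewrite !bnd_simp => /(_ (node_le (leq0n m) (ltnW mM)) (ltW (node_lt mM))).
(* The last cell shares the node m with the previous ones: drop it. *)
rewrite -(@Rintegral_itv_obnd_cbnd _ (node M m) (BRight (node M m.+1)) f)//.
by move=> <-; rewrite addrC subrK.
Qed.

Lemma trace_plus_periodic (v : R -> R) :
  trace_plus M v (ncell M) = trace_plus M v 0.
Proof. by rewrite /trace_plus eqxx if_same. Qed.

Lemma trace_minus_periodic (v : R -> R) :
  trace_minus M v (ncell M) = trace_minus M v 0.
Proof. by rewrite /trace_minus eqxx if_same. Qed.

End Mesh.

(** * Discontinuous piecewise polynomials *)

(** A bounded interval has finite measure: the bound |Q| <= 1 + Q^2 suffices. *)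
Lemma L2_integrable (R : realType) (a b : R) (Q : R -> R) :
  L2 a b Q -> (@lebesgue_measure R).-integrable `[a, b] (EFin \o Q).
Proof.
move=> LQ.
have mQ : measurable_fun `[a, b] Q.
  apply/(measurable_restrictT Q (measurable_itv `[a, b])).
  by have := LQ; rewrite /L2 inE => /andP[/[!inE]].
have iQ2 : (@lebesgue_measure R).-integrable `[a, b]
    (EFin \o (fun x => Q x ^+ 2)).
  have : lebesgue_measure.-integrable `[a, b]
      (EFin \o (fun x => (Q \_ `[a, b]) x ^+ 2)).
    exact: (@integrableS _ _ _ lebesgue_measure setT) (Lfun2_integrable_sqr LQ).
  apply: eq_integrable => // x xab.
  by rewrite /= patchE xab.
have i1 := integrable_horner (1 : {poly R}) a b.
have i1Q2 : (@lebesgue_measure R).-integrable `[a, b]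
    ((EFin \o horner 1) \+ (EFin \o (fun x => (Q x ^+ 2)%R)))%E.
  by apply: integrableD => //; exact: measurable_itv.
apply: le_integrable i1Q2 => //; first exact/measurable_EFinP.
move=> x _ /=; rewrite hornerC lee_fin.
rewrite [leRHS]ger0_norm ?addr_ge0 ?sqr_ge0//.
have := sqr_ge0 (`|Q x| - 1); rewrite -(real_normK (num_real (Q x))).
have := normr_ge0 (Q x); nra.
Qed.

Section DGSpace.
Context {R : realType} {a b : R} {M : mesh a b}.
Local Notation mu := (@lebesgue_measure R).
Implicit Types (v w : R -> R) (Q : R -> R).

Lemma dg_spaceD k v w :
  dg_space M k v -> dg_space M k w -> dg_space M k (fun x => v x + w x).
Proof.
move=> dv dw j jM; have [p sp vp] := dv j jM; have [q sq wq] := dw j jM.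
exists (p + q); last by move=> x xj; rewrite hornerD vp// wq.
by rewrite (leq_trans (size_polyD _ _))// geq_max sp sq.
Qed.

Lemma dg_spaceM k l v w :
  dg_space M k v -> dg_space M l w -> dg_space M (k + l) (fun x => v x * w x).
Proof.
move=> dv dw j jM; have [p sp vp] := dv j jM; have [q sq wq] := dw j jM.
exists (p * q); last by move=> x xj; rewrite hornerM vp// wq.
rewrite (leq_trans (size_polyMleq _ _))// -subn1 leq_subLR add1n.
by rewrite (leq_trans (leq_add sp sq))// addSn addnS.
Qed.

Lemma dg_space_midpoint k (v : nat -> R -> R) n :
  dg_space M k (v n) -> dg_space M k (v n.+1) -> dg_space M k (midpoint v n).
Proof.
move=> dv dv' j jM; have [p sp vp] := dg_spaceD dv' dv jM.
exists (2^-1 *: p); first by rewrite (leq_trans (size_scale_leq _ _)).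
by move=> x xj; rewrite /midpoint hornerZ -vp// mulrC.
Qed.

Lemma dg_space_derive1 k v : dg_space M k v -> dg_space M k (derive1 v).
Proof.
move=> dv j jM; have [p sp vp] := dv j jM; exists p^`().
  by rewrite (leq_trans _ sp)// (leq_trans (size_poly _ _))// leq_pred.
by move=> x xj; exact: derive1_eq_horner xj.
Qed.

Lemma dg_space_integrable k v j : dg_space M k v -> (j < ncell M)%N ->
  mu.-integrable (cell M j) (EFin \o v).
Proof.
move=> dv jM; have [p _ vp] := dv j jM.
exact: integrable_eq_itv_oo vp (integrable_horner _ _ _).
Qed.

(** Integrability of the potential term: a piecewise polynomial is bounded on
the interior of each cell. *)
Lemma L2_dg_integrable k Q v j : L2 a b Q -> dg_space M k v ->
  (j < ncell M)%N -> mu.-integrable (cell M j) (fun x => (v x * Q x)%:E).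
Proof.
move=> LQ dv jM; have [p _ vp] := dv j jM.
apply: (@integrable_eq_itv_oo _ _ (fun x => p.[x] * Q x)) => [x xj|].
  by rewrite vp.
have iQ : mu.-integrable (cell M j) (EFin \o Q).
  apply: integrableS (L2_integrable LQ) => //; first exact: measurable_cell.
  exact: cell_sub.
have cp : {within cell M j, continuous (horner p)}.
  exact: within_continuous_horner.
apply: (integrableMr _ _ _ iQ); first exact: measurable_cell.
  by apply: subspace_continuous_measurable_fun => //; exact: measurable_cell.
have /compact_bounded[N [_ Np]] :=
  continuous_compact cp (@segment_compact _ _ _).
by exists N; split; rewrite ?num_real// => ? ? ? ?; exact: Np.
Qed.

(** * Local balance and conservation of the charge *)

(** Summation by parts for alternating fluxes.  The integral of (v w)' gives the
interior traces v^- w^- on the right and v^+ w^+ on the left of the cell, which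
cancel against one of the two terms of each jump; w^+ v^- is what survives on
both sides, and it depends on the node only, not on the cell. *)
Lemma flux_jump_adjoint k l v w j : dg_space M k v -> dg_space M l w ->
  (j < ncell M)%N ->
  flux_jump M (trace_plus M w) v j
  - \int[mu]_(x in cell M j) (w x * derive1 v x)
  + (flux_jump M (trace_minus M v) w j
     - \int[mu]_(x in cell M j) (v x * derive1 w x)) =
  trace_plus M w j.+1 * trace_minus M v j.+1
  - trace_plus M w j * trace_minus M v j.
Proof.
move=> dv dw jM; have [p _ vp] := dv j jM; have [q _ wq] := dw j jM.
have jlt := node_lt jM.
have tmE u r : {in `]node M j, node M j.+1[, u =1 horner r} ->
    trace_minus M u j.+1 = r.[node M j.+1].
  by move=> ur; exact: lim_at_left_horner jlt ur.
have tpE u r : {in `]node M j, node M j.+1[, u =1 horner r} ->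
    trace_plus M u j = r.[node M j].
  by move=> ur; rewrite /trace_plus (ltn_eqF jM); exact: lim_at_right_horner ur.
have intE u u' (r r' : {poly R}) :
    {in `]node M j, node M j.+1[, u =1 horner r} ->
    {in `]node M j, node M j.+1[, u' =1 horner r'} ->
    \int[mu]_(x in cell M j) (u x * derive1 u' x) =
    \int[mu]_(x in cell M j) (r.[x] * r'^`().[x]).
  move=> ur ur'; apply: Rintegral_eq_itv_oo => [x xj|].
    by rewrite ur// (derive1_eq_horner ur').
  rewrite (_ : EFin \o _ = EFin \o horner (r * r'^`())).
    exact: integrable_horner.
  by apply/funext => x /=; rewrite hornerM.
rewrite (intE _ _ _ _ wq vp) (intE _ _ _ _ vp wq).
rewrite /flux_jump !(tmE _ _ vp) !(tmE _ _ wq) !(tpE _ _ vp) !(tpE _ _ wq).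
have := Rintegration_by_parts_horner q p jlt.
rewrite -/(cell M j).
set A := Rintegral _ _ _; set B := Rintegral _ _ _ => AB.
lra.
Qed.

(** The identity (v1 - v0) (v1 + v0) / 2 = (v1^2 - v0^2) / 2: the midpoint rule
preserves quadratic invariants. *)
Lemma midpoint_energy k (v : nat -> R -> R) n j :
  dg_space M k (v n) -> dg_space M k (v n.+1) -> (j < ncell M)%N ->
  \int[mu]_(x in cell M j) (v n.+1 x ^+ 2)
  - \int[mu]_(x in cell M j) (v n x ^+ 2) =
  2 * (\int[mu]_(x in cell M j) (v n.+1 x * midpoint v n x)
       - \int[mu]_(x in cell M j) (v n x * midpoint v n x)).
Proof.
move=> dv dv' jM; have dm := dg_space_midpoint dv dv'.
have iM u u' : dg_space M k u -> dg_space M k u' ->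
    mu.-integrable (cell M j) (EFin \o (fun x => u x * u' x)).
  by move=> du du'; exact: dg_space_integrable (dg_spaceM du du') jM.
rewrite -RintegralB; [|exact: measurable_cell|exact: iM..].
rewrite -RintegralB; [|exact: measurable_cell|exact: iM..].
rewrite -RintegralZl; [|exact: measurable_cell|]; last first.
  rewrite (_ : EFin \o _ = (EFin \o (fun x => v n.+1 x * midpoint v n x)%R) \-
    (EFin \o (fun x => v n x * midpoint v n x)%R))%E//.
  by apply: integrableB; [exact: measurable_cell|exact: iM..].
by apply: eq_Rintegral => x _; rewrite /midpoint; field.
Qed.

(** The linear combination of the four equations, with a variable for each term:
r1 and mr1 are the integrals of r^2 and r rm at the new time level, flp is the
jump with the flux of p, pr the integral of pm times the derivative of rm, V the
potential and W the noise. *)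
Lemma cell_balance_algebra (dt r1 r0 s1 s0 mr1 mr0 ms1 ms0 flp flr flq fls
    pr rp qs sq pq V W F1 F0 G1 G0 : R) :
  r1 - r0 = 2 * (mr1 - mr0) ->
  s1 - s0 = 2 * (ms1 - ms0) ->
  flp - pr + (flr - rp) = F1 - F0 ->
  flq - qs + (fls - sq) = G1 - G0 ->
  mr1 - mr0 - dt * flp + dt * (pr - V) - W = 0 ->
  pq + sq - fls = 0 ->
  ms1 - ms0 + dt * flq - dt * (qs - V) + W = 0 ->
  pq + rp - flr = 0 ->
  r1 + s1 - (r0 + s0) = 2 * dt * (F1 - F0 - (G1 - G0)).
Proof.
move=> Er Es <- <- e1 /subr0_eq<- e3 /subr0_eq<-; lra.
Qed.

(** The charge of a cell changes only through its ends; up to the factor 2 dt, its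
numerical flux to the right over the step is F s q - F r p. *)
Lemma sldg_cell_balance k (Q : R -> R) dt dW (r p s q : nat -> R -> R) n j :
  let F (v w : nat -> R -> R) i :=
    trace_plus M (midpoint w n) i * trace_minus M (midpoint v n) i in
  L2 a b Q ->
  (forall m, (n <= m <= n.+1)%N -> [/\ dg_space M k (r m), dg_space M k (p m),
    dg_space M k (s m) & dg_space M k (q m)]) ->
  sldg_step M k Q dt (trace_plus M) (trace_minus M) (trace_plus M)
    (trace_minus M) dW r p s q n ->
  (j < ncell M)%N ->
  \int[mu]_(x in cell M j) (r n.+1 x ^+ 2 + s n.+1 x ^+ 2)
  - \int[mu]_(x in cell M j) (r n x ^+ 2 + s n x ^+ 2) =
  2 * dt * ((F r p j.+1 - F r p j) - (F s q j.+1 - F s q j)).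
Proof.
move=> F LQ dg step jM.
have [dr dp ds dq] := dg n (introT andP (conj (leqnn _) (leqnSn _))).
have [dr' dp' ds' dq'] := dg n.+1 (introT andP (conj (leqnSn _) (leqnn _))).
have drm := dg_space_midpoint dr dr'; have dpm := dg_space_midpoint dp dp'.
have dsm := dg_space_midpoint ds ds'; have dqm := dg_space_midpoint dq dq'.
have iM l u l' u' : dg_space M l u -> dg_space M l' u' ->
    mu.-integrable (cell M j) (EFin \o (fun x => u x * u' x)).
  by move=> du du'; exact: dg_space_integrable (dg_spaceM du du') jM.
have mass u u' : dg_space M k u -> dg_space M k u' ->
    \int[mu]_(x in cell M j) (u x ^+ 2 + u' x ^+ 2) =
    \int[mu]_(x in cell M j) (u x ^+ 2) + \int[mu]_(x in cell M j) (u' x ^+ 2).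
  move=> du du'; apply: RintegralD; first exact: measurable_cell.
    exact: (iM _ _ _ _ du du).
  exact: (iM _ _ _ _ du' du').
have potential f g h : dg_space M k f -> dg_space M k g -> dg_space M k h ->
    \int[mu]_(x in cell M j) (f x * derive1 g x - h x * Q x * g x) =
    \int[mu]_(x in cell M j) (f x * derive1 g x)
    - \int[mu]_(x in cell M j) (h x * Q x * g x).
  (* Without integrability of each summand, the integral of the difference
  would say nothing about the two integrals. *)
  move=> df dg' dh; apply: RintegralB; first exact: measurable_cell.
    exact: iM df (dg_space_derive1 dg').
  rewrite (_ : EFin \o _ = fun x => ((h x * g x) * Q x)%:E).
    exact: L2_dg_integrable LQ (dg_spaceM dh dg') jM.
  by apply/funext => x /=; rewrite mulrAC.
have [e1 e2 e3 e4] := step _ _ _ _ drm dqm dsm dpm j jM.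
have noise : \int[mu]_(x in cell M j) (midpoint s n x * midpoint r n x * dW x) =
    \int[mu]_(x in cell M j) (midpoint r n x * midpoint s n x * dW x).
  by apply: eq_Rintegral => x _; rewrite [midpoint s n x * _]mulrC.
have VE : \int[mu]_(x in cell M j) (midpoint s n x * Q x * midpoint r n x) =
    \int[mu]_(x in cell M j) (midpoint r n x * Q x * midpoint s n x).
  by apply: eq_Rintegral => x _; ring.
have qpE : \int[mu]_(x in cell M j) (midpoint q n x * midpoint p n x) =
    \int[mu]_(x in cell M j) (midpoint p n x * midpoint q n x).
  by apply: eq_Rintegral => x _; rewrite mulrC.
rewrite noise potential// VE in e1; rewrite potential// in e3.
rewrite qpE in e4.
rewrite mass// mass//.
have Er := midpoint_energy dr dr' jM; have Es := midpoint_energy ds ds' jM.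
have Ar := flux_jump_adjoint drm dpm jM.
have As := flux_jump_adjoint dsm dqm jM.
exact: cell_balance_algebra Er Es Ar As e1 e2 e3 e4.
Qed.

End DGSpace.

Lemma sum_periodic_flux (V : zmodType) (F : nat -> V) N : F N = F 0%N ->
  \sum_(0 <= j < N) (F j.+1 - F j) = 0.
Proof. by move=> FN; rewrite telescope_sumr// FN subrr. Qed.

Lemma sldg_discrete_charge (R : realType) (a b : R) (M : mesh a b) k
    (Q : R -> R) dt dW (r p s q : nat -> R -> R) n :
  L2 a b Q ->
  (forall m, (n <= m <= n.+1)%N -> [/\ dg_space M k (r m), dg_space M k (p m),
    dg_space M k (s m) & dg_space M k (q m)]) ->
  sldg_step M k Q dt (trace_plus M) (trace_minus M) (trace_plus M)
    (trace_minus M) dW r p s q n ->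
  discrete_charge a b (fun x => Complex (r n.+1 x) (s n.+1 x)) =
  discrete_charge a b (fun x => Complex (r n x) (s n x)).
Proof.
move=> LQ dg step; apply/eqP; rewrite -subr_eq0; apply/eqP.
have chargeE m : (n <= m <= n.+1)%N ->
    discrete_charge a b (fun x => Complex (r m x) (s m x)) =
    \sum_(0 <= j < ncell M)
      \int[lebesgue_measure]_(x in cell M j) (r m x ^+ 2 + s m x ^+ 2).
  move=> /dg[dr _ ds _].
  rewrite -(Rintegral_mesh (M := M)) => [|j jM].
    apply: eq_Rintegral => x _ /=.
    by rewrite sqr_sqrtr// addr_ge0// sqr_ge0.
  exact: dg_space_integrable (dg_spaceD (dg_spaceM dr dr) (dg_spaceM ds ds)) jM.
rewrite !chargeE ?leqnn ?leqnSn//.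
rewrite -sumrB; under eq_big_nat => j /andP[_ jM] do
  rewrite (sldg_cell_balance LQ dg step jM).
rewrite -mulr_sumr sumrB !sum_periodic_flux ?subrr ?mulr0//.
all: by rewrite trace_plus_periodic trace_minus_periodic.
Qed.


Theorem theorem2p1 (R : realType)
  (d : measure_display) (Omega : measurableType d) (P : probability Omega R)
  (Lf Lr : R) (hL : Lf < Lr)
  (T : R) (hT : 0 < T) (N : nat) (hN : (0 < N)%N)
  (Q : R -> R) (hQ : sobolev Lf Lr 3 Q)
  (gamma : R) (hgamma : 0 <= gamma)
  (e : nat -> R -> R) (he : orthonormal_basis Lf Lr e)
  (phi : (R -> R) -> (R -> R)) (hphi : hilbert_schmidt Lf Lr gamma phi)
  (B : nat -> R -> {RV P >-> R}) (hB : independent_brownian_motions B)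
  (dW : nat -> Omega -> R -> R)
  (hdW : forall n, (n <= N)%N ->
     truncated_increment Lf Lr B phi e (T / N%:R) n (dW n))
  (c : R) (hc : 0 < c) (M : mesh Lf Lr)
  (hM : forall j, (j < ncell M)%N -> c * mesh_size M <= cell_size M j)
  (k : nat) (r p s q : nat -> Omega -> R -> R)
  (hsol : {ae P, forall w,
     sldg_solution M k N Q (T / N%:R)
       (trace_plus M) (trace_minus M) (trace_plus M) (trace_minus M)
       (dW ^~ w) (r ^~ w) (p ^~ w) (s ^~ w) (q ^~ w)}) :
  let u (n : nat) (w : Omega) (x : R) : R[i] :=
    Complex (r n w x) (s n w x) in
  {ae P, forall w, forall n, (n <= N)%N ->
     discrete_charge Lf Lr (u n.+1 w) = discrete_charge Lf Lr (u n w)}.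
Proof.
move=> u; apply: filterS hsol => w [dg step] n nN.
apply: (sldg_discrete_charge hQ.1) (step n nN) => m /andP[_ mn].
by apply: dg; exact: leq_trans mn _.
Qed.
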